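(* For all sufficiently large $n$ the following holds. Let $m=cn$ where $10^4\le c\le n/10^{10}$, and let $\beta^*=\max\{e^{-c/6},1/n\}$. Then with probability at least $1-n^{-15}$ over $G\sim\mathcal{G}_{n,m}$, for all $\beta$ with $\beta^*\le\beta\le 1$, the graph $G$ is $(\beta,\beta/240)$-asymmetric.
   Context: $\mathcal{G}_{n,m}$ is the uniform distribution over simple graphs on $n$ vertices with exactly $m$ edges. For a graph $G=(V,E)$ and a permutation $\pi$ of $V$, $\mathrm{AUT}(G;\pi)=|\{e\in E:\pi(e)\in E\}|/|E|$. A graph $G$ is $(\beta,\gamma)$-asymmetric if every permutation $\pi$ of $V(G)$ having at most a $(1-\beta)$ fraction of the vertices as fixed points satisfies $\mathrm{AUT}(G;\pi)<1-\gamma$. *)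

(* Defs.v *)
From Stdlib Require Import Reals ClassicalEpsilon.
From mathcomp Require Import all_boot perm.
Set Implicit Arguments. Unset Strict Implicit. Unset Printing Implicit Defensive.
Local Open Scope R_scope.

Definition bool_of (P : Prop) : bool :=
  if excluded_middle_informative P then true else false.

(* A simple graph on vertex set 'I_n is given by its edge set: a set of
   2-element subsets of 'I_n. *)
Definition is_simple_graph n (E : {set {set 'I_n}}) : bool :=
  [forall e in E, #|e| == 2%N].

Definition Gnm_support n m : {set {set {set 'I_n}}} :=
  [set E | is_simple_graph E && (#|E| == m)%N].

Definition perm_edge n (pi : {perm 'I_n}) (e : {set 'I_n}) : {set 'I_n} :=
  pi @: e.

Definition AUT n (E : {set {set 'I_n}}) (pi : {perm 'I_n}) : R :=
  INR #|[set e in E | perm_edge pi e \in E]| / INR #|E|.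

Definition nfix n (pi : {perm 'I_n}) : nat := #|[set x | pi x == x]|.

Definition asymmetric n (E : {set {set 'I_n}}) (beta gamma : R) : Prop :=
  forall pi : {perm 'I_n},
    INR (nfix pi) <= (1 - beta) * INR n -> AUT E pi < 1 - gamma.

Definition prob_Gnm n m (P : {set {set 'I_n}} -> Prop) : R :=
  INR #|[set E in Gnm_support n m | bool_of (P E)]|
     / INR #|Gnm_support n m|.

(* Main.v *)
(* Let [S] be the set of the [k] points moved by [pi].  A graph with
   [AUT E pi >= 1 - k / (240 n)] either has at most [ck/50] edges touching [S],
   or most edges touching [S] are sent by [pi] to other edges.  The first event
   depends only on [S]; a hypergeometric tail bound beats the union bound over
   the [C(n,k) <= exp (ck/6 + k)] sets [S], which is where the lower bound
   [exp (-c/6)] on [beta] enters.  In the second event one extracts a set [Y] of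
   at least [ck/200] pairs, disjoint from its image, with both [Y] and [pi Y]
   contained in [E]: there are at most [C(kn,r)] sets [Y] of size [r], each
   occurs with probability at most [(m/C(n,2))^(2r)], and the product is
   at most [(2500c/n)^r], which beats the [n^k] permutations moving [k] points. *)

Require Import Defs.
From Stdlib Require Import Reals ZArith Lra Lia Classical ClassicalEpsilon.
From mathcomp Require Import all_boot perm.
Set Implicit Arguments. Unset Strict Implicit. Unset Printing Implicit Defensive.
Local Open Scope R_scope.

(** * Binomial coefficients, the union bound and exponential bounds *)

(** [E] is determined by its two traces [E :&: A] and [E :\: A], which are chosen among the
    [j]-subsets of [A] and the [(m - j)]-subsets of [D :\: A]. *)
Lemma card_draws_setI (T : finType) (D A : {set T}) m j :
  (#|[set E : {set T} | [&& E \subset D, #|E| == m & #|E :&: A| == j]]|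
     <= 'C(#|A|, j) * 'C(#|D :\: A|, m - j))%N.
Proof.
rewrite -2!cards_draws -cardsX.
set U := [set E | _].
pose f (E : {set T}) := (E :&: A, E :\: A).
have f_inj : injective f by move=> E F [h1 h2]; rewrite -(setID E A) h1 h2 setID.
rewrite -(card_imset (mem U) f_inj); apply: subset_leq_card.
apply/subsetP=> _ /imsetP[E + ->]; rewrite !inE /= => /and3P[sED /eqP cE /eqP cEA].
by rewrite subsetIr cEA eqxx setSD //= cardsD cE cEA eqxx.
Qed.

(** After multiplication by [r!] this compares factor by factor: [(a - i) / (b - i) <= a / b] for
    [a <= b]. *)
Lemma bin_expn_le a b r : (a <= b)%N -> ('C(a, r) * b ^ r <= 'C(b, r) * a ^ r)%N.
Proof.
move=> le_ab; rewrite -(leq_pmul2r (fact_gt0 r)) mulnAC [leqRHS]mulnAC !bin_ffact.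
elim: r => [//|r IH]; rewrite !ffactnSr !expnSr.
rewrite mulnACA [leqRHS]mulnACA; apply: leq_mul => //.
by rewrite !mulnBl [(b * a)%N]mulnC leq_sub2l // leq_mul2l le_ab orbT.
Qed.

(** The ratio ['C(M - j, m - j) / 'C(M, m)] is the product of the [(m - i) / (M - i)] for [i < j],
    each at most [m / M]. *)
Lemma bin_sub_expn_le M m j : (j <= m)%N -> (m <= M)%N ->
  ('C(M - j, m - j) * M ^ j <= 'C(M, m) * m ^ j)%N.
Proof.
move=> jm mM; elim: j jm => [|j IH] jm; first by rewrite !subn0.
have {}IH := IH (ltnW jm).
have Mj : (0 < M - j)%N by rewrite subn_gt0 (leq_trans jm).
have e : ((M - j) * 'C(M - j.+1, m - j.+1) = (m - j) * 'C(M - j, m - j))%N.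
  have -> : (M - j = (M - j.+1).+1)%N by rewrite subnSK // (leq_trans jm).
  have -> : (m - j = (m - j.+1).+1)%N by rewrite subnSK.
  by rewrite mul_bin_diag.
rewrite -(leq_pmul2l Mj) mulnA e expnSr.
have -> : ((m - j) * 'C(M - j, m - j) * (M ^ j * M) =
           ('C(M - j, m - j) * M ^ j) * ((m - j) * M))%N.
  by rewrite [((m - j) * _)%N]mulnC -!mulnA; congr muln; rewrite mulnCA.
apply: leq_trans (leq_mul IH (leqnn _)) _.
rewrite expnSr.
have -> : ((M - j) * ('C(M, m) * (m ^ j * m)) = 'C(M, m) * m ^ j * ((M - j) * m))%N.
  by rewrite mulnC -!mulnA; do 2!congr muln; rewrite mulnC.
rewrite leq_mul2l; apply/orP; right.
by rewrite !mulnBl [(m * M)%N]mulnC leq_sub2l // leq_mul2l mM orbT.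
Qed.

Lemma INR_expn (a b : nat) : INR (a ^ b)%N = INR a ^ b.
Proof. by elim: b => [|b IH] //=; rewrite expnS mult_INR IH. Qed.

(** The left side is one term of the binomial expansion of the right side. *)
Lemma INR_bin_mul_pow_le (N j : nat) (x : R) : 0 <= x ->
  INR 'C(N, j) * x ^ j <= (1 + x) ^ N.
Proof.
move=> x0; elim: N j => [|N IH] [|j].
- by rewrite bin0 /=; lra.
- by rewrite bin0n /=; lra.
- have := IH 0%N; rewrite !bin0 /= => h.
  have : 0 <= x * (1 + x) ^ N by apply: Rmult_le_pos => //; apply: pow_le; lra.
  lra.
- rewrite binS plus_INR; have h1 := IH j.+1; have h2 := IH j.
  have := Rmult_le_compat_l _ _ _ x0 h2.
  rewrite /= in h1 *; nra.
Qed.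


Lemma INR_leq (a b : nat) : (a <= b)%N -> INR a <= INR b.
Proof. by move=> h; apply: le_INR; apply/leP. Qed.

(** The union bound in counting form; every probability estimate below is summed through it. *)
Lemma card_bigcup_le (I T : finType) (P : pred I) (B : I -> {set T}) (x : R) :
  (forall i, P i -> INR #|B i| <= x) ->
  INR #|\bigcup_(i | P i) B i| <= INR #|P| * x.
Proof.
move=> hB; rewrite -(sum1_card P).
rewrite [in INR (\sum_(i in P) 1)]big_mkcond /= -big_mkcond.
elim/big_rec2: _ => [|i s A Pi IH]; first by rewrite cards0 /=; lra.
apply: (Rle_trans _ (INR (#|B i| + #|A|)%N)).
  by apply: INR_leq; rewrite cardsU leq_subr.
by rewrite !plus_INR /=; have := hB i Pi; lra.
Qed.

Lemma pow_1plus_le_exp (x : R) (n : nat) : 0 <= 1 + x ->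
  (1 + x) ^ n <= exp (INR n * x).
Proof.
move=> x0; elim: n => [|n IH]; first by rewrite Rmult_0_l exp_0 /=; lra.
rewrite S_INR Rmult_plus_distr_r Rmult_1_l exp_plus /= Rmult_comm.
apply: Rmult_le_compat => //; [exact: pow_le | exact: exp_ineq1_le].
Qed.

Lemma INR_bin_le_exp (N j : nat) (x : R) : 0 <= x ->
  INR 'C(N, j) * x ^ j <= exp (INR N * x).
Proof.
move=> x0; apply: Rle_trans (INR_bin_mul_pow_le _ _ x0) _.
by apply: pow_1plus_le_exp; lra.
Qed.

Lemma pow_exp (x : R) (n : nat) : exp x ^ n = exp (INR n * x).
Proof.
elim: n => [|n IH]; first by rewrite Rmult_0_l exp_0.
by rewrite S_INR Rmult_plus_distr_r Rmult_1_l exp_plus /= IH Rmult_comm.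
Qed.

Lemma exp5_ge_100 : 100 <= exp 5.
Proof.
(* Since [exp (/ 8) >= 9 / 8], it is enough that [(9 / 8) ^ 40 >= 100], a rational computation. *)
have -> : exp 5 = exp (/ 8) ^ 40 by rewrite pow_exp; f_equal; rewrite INR_IZR_INZ /=; lra.
have h := exp_ineq1_le (/ 8).
apply: (Rle_trans _ ((1 + / 8) ^ 40)); first by lra.
by apply: pow_incr; lra.
Qed.

Lemma exp_le_exp (x y : R) : x <= y -> exp x <= exp y.
Proof. by case=> [h|->]; [left; exact: exp_increasing | exact: Rle_refl]. Qed.

(** * Uniform [m]-subsets of a finite set: containment and lower tail *)

Section Hypergeometric.
Variables (T : finType) (D : {set T}) (m : nat).
Let M := #|D|.
Hypothesis M0 : (0 < M)%N.
Hypothesis mM : (m <= M)%N.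

Let M0R : 0 < INR M. Proof. by apply: lt_0_INR; apply/ltP. Qed.

Lemma INR_bin_sub_le j : (j <= m)%N ->
  INR 'C(M - j, m - j) <= (INR m / INR M) ^ j * INR 'C(M, m).
Proof.
move=> jm; have /INR_leq := bin_sub_expn_le jm mM.
rewrite !mult_INR !INR_expn => h.
have Mj : 0 < INR M ^ j by apply: pow_lt.
apply: (Rmult_le_reg_r (INR M ^ j)) => //.
rewrite /Rdiv Rpow_mult_distr pow_inv; apply: Rle_trans h _.
by right; field; lra.
Qed.

(** The case [A = F], [j = #|F|] of the trace count: sampling without replacement is no likelier to
    contain [F] than independent sampling at density [m / M]. *)
Lemma card_supersets_le (F : {set T}) : F \subset D ->
  INR #|[set E : {set T} | [&& E \subset D, #|E| == m & F \subset E]]|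
    <= (INR m / INR M) ^ #|F| * INR 'C(M, m).
Proof.
move=> sFD.
have [Fm|mF] := leqP #|F| m; last first.
  rewrite (_ : [set E | _] = set0) ?cards0 /=; last first.
    apply/setP=> E; rewrite !inE; apply/negP=> /and3P[_ /eqP cE /subset_leq_card].
    by rewrite cE leqNgt mF.
  apply: Rmult_le_pos; last exact: pos_INR.
  apply: pow_le; apply: Rmult_le_pos; first exact: pos_INR.
  by left; apply: Rinv_0_lt_compat.
apply: Rle_trans (INR_bin_sub_le Fm); apply: INR_leq.
have := card_draws_setI D F m #|F|; rewrite binn mul1n cardsD (setIidPr sFD).
apply: leq_trans; apply: subset_leq_card; apply/subsetP=> E; rewrite !inE.
by case/and3P=> -> -> /= /setIidPr ->.
Qed.

(** With [p = m / M], the count is at most ['C(N, j) * p ^ j * X * 'C(M, m)], where [X] bounds the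
    chance that the other [m - j] elements avoid [A]. The constant [6.01] collects [5] from the
    weight [100 ^ j], [1] from [N / M <= 1] and [1 / 100] from [p]. *)
Lemma card_draws_setI_le_exp (A : {set T}) j : A \subset D ->
  INR m / INR M <= / 100 -> (j <= m)%N ->
  INR #|[set E : {set T} | [&& E \subset D, #|E| == m & #|E :&: A| == j]]|
    <= exp (- (99 / 100) * (INR #|A| * INR m / INR M) + 6.01 * INR j) * INR 'C(M, m).
Proof.
move=> sAD p100 jm; set N := #|A|; set p := INR m / INR M.
have p0 : 0 <= p.
  apply: Rmult_le_pos; [exact: pos_INR | by left; apply: Rinv_0_lt_compat].
have NM : (N <= M)%N by apply: subset_leq_card.
have B0 := pos_INR 'C(M, m).
apply: (Rle_trans _ (INR ('C(N, j) * 'C(M - N, m - j))%N)).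
  by apply: INR_leq; have := card_draws_setI D A m j; rewrite cardsD (setIidPr sAD).
have [jN|Nj] := leqP j N; last first.
  rewrite bin_small // mul0n /=; apply: Rmult_le_pos => //; left; exact: exp_pos.
have jM : (j <= M)%N by apply: leq_trans jm mM.
have NR := INR_leq NM. have jNR := INR_leq jN. have jMR := INR_leq jM.
have jmR := INR_leq jm. have mMR := INR_leq mM.
have j0 := pos_INR j. have N0 := pos_INR N.
set X := exp (- ((INR N - INR j) * (INR m - INR j) / INR M)).
have h1 : INR 'C(M - N, m - j) <= X * INR 'C(M - j, m - j).
  (* The ratio below has denominator [M - j]; if [j = M], then [N], [j] and [m] all equal [M] and
     [X = 1]. *)
  have [jltM|] := ltnP j M; last first.
    move=> Mj; have eN : N = M by apply/eqP; rewrite eqn_leq NM (leq_trans Mj).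
    have ej : j = M by apply/eqP; rewrite eqn_leq jM.
    have em : m = M by apply/eqP; rewrite eqn_leq mM -ej.
    rewrite /X eN ej em Rminus_diag Rmult_0_l /Rdiv Rmult_0_l Ropp_0 exp_0; lra.
  have jltMR : INR j < INR M by apply: lt_INR; apply/ltP.
  have := bin_expn_le (m - j) (leq_sub2l M jN) => /INR_leq.
  rewrite !mult_INR !INR_expn !(minus_INR M) ?(minus_INR m); try by apply/leP.
  move=> h.
  have Q0 : 0 < (INR M - INR j) ^ (m - j) by apply: pow_lt; lra.
  apply: (Rmult_le_reg_r _ _ _ Q0); apply: Rle_trans h _.
  rewrite Rmult_comm (Rmult_comm X) (Rmult_comm _ (_ ^ _)) -!Rmult_assoc (Rmult_comm _ (INR 'C(_, _))).
  rewrite (Rmult_comm _ (INR 'C(_, _))) !Rmult_assoc; apply: Rmult_le_compat_l; first exact: pos_INR.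
  (* [1 + y] is the ratio [(M - N) / (M - j)]; in the exponent the denominator [M - j] is then
     weakened to [M]. *)
  set y := - ((INR N - INR j) / (INR M - INR j)).
  have y1 : 0 <= 1 + y.
    have -> : 1 + y = (INR M - INR N) * / (INR M - INR j) by rewrite /y; field; lra.
    apply: Rmult_le_pos; [lra | left; apply: Rinv_0_lt_compat; lra].
  have -> : INR M - INR N = (INR M - INR j) * (1 + y) by rewrite /y; field; lra.
  rewrite Rpow_mult_distr; apply: Rmult_le_compat_l; first lra.
  apply: Rle_trans (pow_1plus_le_exp _ y1) _; apply: exp_le_exp.
  rewrite minus_INR; last by apply/leP.
  rewrite /y /Rdiv -Ropp_mult_distr_r; apply: Ropp_le_contravar.
  rewrite (Rmult_comm (INR N - _)) -Rmult_assoc Rmult_assoc.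
  rewrite Rmult_assoc; apply: Rmult_le_compat_l; first lra.
  apply: Rmult_le_compat_l; first lra.
  by apply: Rinv_le_contravar; lra.
have h2 := INR_bin_sub_le jm.
(* Weigh the binomial term by [p / 100] instead of [p]; [100 ^ j <= exp (5 j)] pays for it. *)
have h3 : INR 'C(N, j) * p ^ j <= exp (5 * INR j + INR N * p / 100).
  have := @INR_bin_le_exp N j (p / 100) ltac:(lra).
  have -> : p ^ j = (p / 100) ^ j * 100 ^ j by rewrite -Rpow_mult_distr; f_equal; field.
  move=> h; rewrite -Rmult_assoc (Rmult_comm 5) exp_plus Rmult_comm.
  apply: Rmult_le_compat => //; first by apply: pow_le; lra.
  - by apply: Rmult_le_pos; [exact: pos_INR | apply: pow_le; lra].
  - by rewrite -pow_exp; apply: pow_incr; have := exp5_ge_100; lra.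
  - by apply: Rle_trans h _; apply: exp_le_exp; lra.
have X0 : 0 < X := exp_pos _.
rewrite mult_INR.
apply: (Rle_trans _ (INR 'C(N, j) * (X * (p ^ j * INR 'C(M, m))))).
  apply: Rmult_le_compat_l; first exact: pos_INR.
  by apply: Rle_trans h1 _; apply: Rmult_le_compat_l; [lra | exact: h2].
rewrite (_ : _ * _ = X * (INR 'C(N, j) * p ^ j) * INR 'C(M, m)); last by ring.
apply: Rmult_le_compat_r => //.
apply: (Rle_trans _ (X * exp (5 * INR j + INR N * p / 100))).
  by apply: Rmult_le_compat_l; lra.
rewrite /X -exp_plus; apply: exp_le_exp.
have -> : (INR N - INR j) * (INR m - INR j) / INR M =
  INR N * p - INR j * p - INR j * (INR N / INR M) + INR j * INR j / INR M.
  by rewrite /p; field; lra.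
have -> : INR N * INR m / INR M = INR N * p by rewrite /p; field; lra.
have : INR j * p <= INR j * / 100 by apply: Rmult_le_compat_l.
have : INR j * (INR N / INR M) <= INR j * 1.
  apply: Rmult_le_compat_l => //; apply: (Rmult_le_reg_r (INR M)) => //.
  by rewrite /Rdiv Rmult_assoc Rinv_l ?Rmult_1_r ?Rmult_1_l //; apply: Rgt_not_eq.
have : 0 <= INR j * INR j / INR M.
  by apply: Rmult_le_pos; [apply: Rmult_le_pos | left; apply: Rinv_0_lt_compat].
lra.
Qed.

(** The pointwise bound increases with [j], so each of the [t + 1] values [j <= t] costs at most the
    bound at [t]. *)
Lemma card_draws_lower_tail (A : {set T}) t : A \subset D ->
  INR m / INR M <= / 100 -> (t <= m)%N ->
  INR #|[set E : {set T} | [&& E \subset D, #|E| == m & (#|E :&: A| <= t)%N]]|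
    <= (INR t + 1) * exp (- (99 / 100) * (INR #|A| * INR m / INR M) + 6.01 * INR t)
       * INR 'C(M, m).
Proof.
move=> sAD p100 tm; rewrite Rmult_assoc -S_INR -[in INR t.+1](card_ord t.+1).
set x := exp _ * _.
pose B (j : 'I_t.+1) := [set E : {set T} | [&& E \subset D, #|E| == m & #|E :&: A| == j]].
apply: (Rle_trans _ (INR #|\bigcup_j B j|)).
  apply: INR_leq; apply: subset_leq_card; apply/subsetP=> E; rewrite inE => /and3P[sE cE h].
  apply/bigcupP; exists (inord #|E :&: A|) => //.
  by rewrite inE sE cE inordK //= ltnS.
apply: card_bigcup_le => j _.
have jt : (j <= t)%N by rewrite -ltnS.
apply: Rle_trans (card_draws_setI_le_exp sAD p100 (leq_trans jt tm)) _.
apply: Rmult_le_compat_r; first exact: pos_INR.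
by apply: exp_le_exp; have := INR_leq jt; lra.
Qed.

End Hypergeometric.

(** * Extracting a set disjoint from its image *)

(** For an inclusion-maximal [Y], the sets [Y], [f @: Y] and [f @^-1: Y] cover [X], and injectivity
    bounds each by [#|Y|]. *)
Lemma exists_disjoint_image (T : finType) (f : T -> T) (X : {set T}) :
  injective f -> (forall x, x \in X -> f x != x) ->
  exists Y : {set T},
    [/\ Y \subset X, [disjoint Y & f @: Y] & (#|X| <= 3 * #|Y|)%N].
Proof.
move=> f_inj f_neq.
pose P (Y : {set T}) := (Y \subset X) && [disjoint Y & f @: Y].
have P0 : exists Y, P Y by exists set0; rewrite /P sub0set disjoints_subset sub0set.
have [Y /maxsetP[/andP[sYX dY] maxY]] := ex_maxset P0.
exists Y; split=> //.
(* Maximality: a point of [X] outside these three sets could be added to [Y]. *)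
suff sX : X \subset Y :|: (f @: Y :|: f @^-1: Y).
  apply: leq_trans (subset_leq_card sX) _.
  apply: leq_trans (leq_card_setU _ _) _.
  rewrite mulSn leq_add2l; apply: leq_trans (leq_card_setU _ _) _.
  rewrite mulSn mul1n card_imset // leq_add2l -(card_imset _ f_inj).
  by apply: subset_leq_card; apply/subsetP=> _ /imsetP[x + ->]; rewrite inE.
apply/subsetP=> e eX; apply: contraT; rewrite !inE !negb_or => /and3P[eY efY feY].
suff /maxY eq_Y : P (e |: Y).
  by move: eY; rewrite -(eq_Y (subsetUr _ _)) setU11.
rewrite /P subUset sub1set eX sYX /=.
apply/pred0P=> a /=; apply/negP=> /andP[].
rewrite !inE => /orP[/eqP->|aY] /imsetP[b]; rewrite !inE => /orP[/eqP->|bY] ab.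
- by move: (f_neq e eX); rewrite -ab eqxx.
- by move: efY; rewrite ab imset_f.
- by move: feY; rewrite -ab aY.
- by move: (disjointFr dY aY); rewrite ab imset_f.
Qed.

(** * Edges meeting the set of points moved by a permutation *)

Definition pairs n : {set {set 'I_n}} := [set e : {set 'I_n} | #|e| == 2%N].

Definition moved n (pi : {perm 'I_n}) : {set 'I_n} := [set x | pi x != x].

(** Meeting [S] is phrased as non-inclusion in [~: S], so that the remaining pairs are the 2-subsets
    of [~: S]. *)
Definition touching n (S : {set 'I_n}) : {set {set 'I_n}} :=
  [set e in pairs n | ~~ (e \subset ~: S)].

Lemma card_pairs n : #|pairs n| = 'C(n, 2).
Proof. by rewrite card_draws card_ord. Qed.

Lemma Gnm_supportE n m :
  Gnm_support n m = [set E : {set {set 'I_n}} | (E \subset pairs n) && (#|E| == m)].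
Proof.
apply/setP=> E; rewrite !inE; congr andb.
apply/forall_inP/subsetP => h e eE; first by rewrite inE h.
by have := h e eE; rewrite inE.
Qed.

Lemma card_Gnm_support n m : #|Gnm_support n m| = 'C('C(n, 2), m).
Proof. by rewrite Gnm_supportE cards_draws card_pairs. Qed.

Lemma touching_sub n (S : {set 'I_n}) : touching S \subset pairs n.
Proof. by apply/subsetP=> e; rewrite !inE => /andP[]. Qed.

Lemma card_touching n (S : {set 'I_n}) :
  (#|touching S| + 'C(n - #|S|, 2) = 'C(n, 2))%N.
Proof.
have -> : 'C(n - #|S|, 2) = #|pairs n :\: touching S|.
  have -> : (n - #|S| = #|~: S|)%N by rewrite -[X in (X - _)%N](card_ord n) -(cardsC S) addKn.
  rewrite -cards_draws.
  by apply: eq_card => e; rewrite !inE; case: (#|e| == 2%N); rewrite /= ?andbF ?andbT ?negbK.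
by rewrite -card_pairs -(cardsID (touching S) (pairs n)) (setIidPr (touching_sub S)).
Qed.

Lemma card_moved n (pi : {perm 'I_n}) : (#|moved pi| + nfix pi = n)%N.
Proof.
rewrite addnC -[RHS](card_ord n) -(cardsC [set x | pi x == x]); congr addn.
by apply: eq_card => x; rewrite !inE.
Qed.

(** The image of a moved point is again moved, and differs from it. *)
Lemma card_moved_neq1 n (pi : {perm 'I_n}) : #|moved pi| != 1%N.
Proof.
apply/negP=> /cards1P[x /setP h].
have := h (pi x); have := h x; rewrite !inE eqxx (inj_eq perm_inj) => nx.
by rewrite nx => /esym e; rewrite e in nx.
Qed.

(** A pair preserved as a set and containing a moved point [x] must be [[set x; pi x]], so moved
    points index all such pairs. *)
Lemma card_fixed_touching n (pi : {perm 'I_n}) :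
  (#|[set e in touching (moved pi) | perm_edge pi e == e]| <= #|moved pi|)%N.
Proof.
apply: leq_trans (leq_imset_card (fun x => [set x; pi x]) (mem (moved pi))).
apply: subset_leq_card; apply/subsetP=> e; rewrite !inE.
case/andP=> /andP[/eqP ce /subsetPn[x xe xS]] /eqP pe.
have {}xS : x \in moved pi by move: xS; rewrite inE negbK.
apply/imsetP; exists x => //; apply/esym/eqP.
rewrite eqEcard ce cards2 subUset !sub1set xe -{1}pe imset_f //=.
by move: xS; rewrite inE eq_sym => ->.
Qed.

(** [Y] is extracted from the touching edges sent to a different edge. Every other touching edge is
    either sent to a non-edge or preserved as a set, and these give the last two terms. *)
Lemma exists_stable_edges n (E : {set {set 'I_n}}) (pi : {perm 'I_n}) :
  exists Y : {set {set 'I_n}},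
    [/\ Y \subset E :&: touching (moved pi), perm_edge pi @: Y \subset E,
        [disjoint Y & perm_edge pi @: Y] &
        (#|E :&: touching (moved pi)| <=
          3 * #|Y| + #|[set e in E | perm_edge pi e \notin E]| + #|moved pi|)%N].
Proof.
set S := moved pi; set f := perm_edge pi.
pose X := [set e in E :&: touching S | (f e \in E) && (f e != e)].
have f_inj : injective f by apply: imset_inj; exact: perm_inj.
have [|Y [sYX dY cY]] := @exists_disjoint_image _ f X f_inj.
  by move=> e; rewrite inE => /and3P[].
exists Y; split=> //.
- by apply: subset_trans sYX _; apply/subsetP=> e; rewrite inE => /andP[].
- by apply/subsetP=> _ /imsetP[e /(subsetP sYX) + ->]; rewrite inE => /and3P[].
pose F := [set e in touching S | f e == e].
apply: (@leq_trans #|X :|: [set e in E | f e \notin E] :|: F|).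
  apply: subset_leq_card; apply/subsetP=> e /setIP[eE eS]; rewrite !inE in eS *.
  by rewrite eE eS /=; case: (f e \in E) => //=; case: (f e == e).
apply: leq_trans (leq_card_setU _ _) _; apply: leq_add; last exact: card_fixed_touching.
by apply: leq_trans (leq_card_setU _ _) _; rewrite leq_add2r.
Qed.

Lemma card_perms_moved n (S : {set 'I_n}) :
  (#|[set pi : {perm 'I_n} | moved pi == S]| <= #|S|`!)%N.
Proof.
rewrite -card_perm; apply: subset_leq_card; apply/subsetP=> pi.
rewrite inE => /eqP <-; apply/subsetP=> x.
by rewrite !inE.
Qed.

(** * Real estimates for the two union bounds *)

(** [up x] is the integer in [(x, x + 1]], hence the shift by one. *)
Definition nat_floor (x : R) : nat := Z.to_nat (up x - 1).

Lemma nat_floorP (x : R) : 0 <= x -> INR (nat_floor x) <= x < INR (nat_floor x) + 1.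
Proof.
move=> x0; have [h1 h2] := archimed x.
have z0 : (0 < up x)%Z by apply: lt_IZR; lra.
by rewrite /nat_floor INR_IZR_INZ Z2Nat.id ?minus_IZR; [lra | lia].
Qed.

(** The square of [exp (x / 2) >= 1 + x / 2]; this quadratic growth serves for the comparisons
    between scales below. *)
Lemma sqr_div4_le_exp (x : R) : 0 <= x -> x * x / 4 <= exp x.
Proof.
move=> x0; have -> : x = x / 2 + x / 2 by field.
rewrite exp_plus; have h := exp_ineq1_le (x / 2); nra.
Qed.

Lemma exp_le_inv (x y : R) : exp x <= exp y -> x <= y.
Proof. by case=> [/exp_lt_inv|/exp_inv ->]; [left | exact: Rle_refl]. Qed.

(** Here [n = exp L], and [c * k * ((2 * n - k - 1) / (n - 1))] is the mean number of edges touching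
    a [k]-set. It is at least [c * k], and nearly twice that when [k] is small. *)
Lemma few_touching_estimate (L k c t : R) :
  10 ^ 9 <= L -> 2 <= k <= exp L -> 10 ^ 4 <= c ->
  exp L * exp (- c / 6) <= k -> 0 <= t <= c * k / 50 ->
  exp (c * k / 6 + k) *
    ((t + 1) * exp (- (99 / 100) * (c * k * ((2 * exp L - k - 1) / (exp L - 1))) + 6.01 * t))
  <= exp (- 17 * L).
Proof.
move=> L0 [k2 kn] c0 hk [t0 tw].
set n := exp L in kn hk *; set w := c * k in tw *.
have wk : 10 ^ 4 * k <= w by apply: Rmult_le_compat_r; lra.
have nL : L <= n by have := @sqr_div4_le_exp L ltac:(lra); rewrite -/n; nra.
have t1 : t + 1 <= exp (w / 100).
  by have := @sqr_div4_le_exp (w / 100) ltac:(lra); nra.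
set mu := w * _.
apply: (Rle_trans _ (exp (w / 6 + k) * (exp (w / 100) * exp (- (99 / 100) * mu + 6.01 * t)))).
  apply: Rmult_le_compat_l; first by left; apply: exp_pos.
  by apply: Rmult_le_compat_r => //; left; apply: exp_pos.
rewrite -!exp_plus; apply: exp_le_exp.
(* For large [w], [mu >= w] suffices: the exponent is at most [- 0.69 * w], and [0.69 * 26 > 17]. *)
have [big|small] := Rle_lt_dec (26 * L) w.
  have : w * 1 <= mu.
    apply: Rmult_le_compat_l; first lra.
    apply: (Rmult_le_reg_r (n - 1)); first lra.
    by rewrite /Rdiv Rmult_assoc Rinv_l; lra.
  lra.
(* Now [k] is tiny, so [mu >= 1.98 * w], and [exp L * exp (- c / 6) <= k <= exp (L / 8)] forces
   [c >= 5.25 * L]. As [k >= 2], [w >= 10.5 * L]; the exponent is at most [- 1.66 * w], and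
   [1.66 * 10.5 > 17]. *)
have kL : k <= L / 100 by lra.
have k8 : k <= exp (L / 8).
  by have := @sqr_div4_le_exp (L / 8) ltac:(lra); nra.
have cL : L - c / 6 <= L / 8.
  apply: exp_le_inv; apply: Rle_trans k8; apply: Rle_trans hk.
  by rewrite /n -exp_plus; right; f_equal; field.
have : w * 1.98 <= mu.
  apply: Rmult_le_compat_l; first lra.
  apply: (Rmult_le_reg_r (n - 1)); first lra.
  by rewrite /Rdiv Rmult_assoc Rinv_l; lra.
have : 5.25 * L * 2 <= w by apply: Rmult_le_compat; lra.
lra.
Qed.

(** Each of the [r] pairs gains [L - l] with [l = ln (2500 * c)]. For small [c] the gain is at least
    [L / 2] and [r >= 50 * k]; for large [c] it is only [1], but then [r >= 18 * L * k]. *)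
Lemma stable_pairs_estimate (L k c r : R) :
  10 ^ 9 <= L -> 2 <= k -> 10 ^ 4 <= c <= exp L / 10 ^ 10 -> c * k / 200 <= r ->
  k * L + r * ln (2500 * c / exp L) <= - 17 * L.
Proof.
move=> L0 k2 [c0 c1] hr.
have n0 := exp_pos L.
have eq : ln (2500 * c / exp L) = ln (2500 * c) - L.
  by rewrite /Rdiv ln_mult ?ln_Rinv ?ln_exp //; try apply: Rinv_0_lt_compat; lra.
have wk : 10 ^ 4 * k <= c * k by apply: Rmult_le_compat_r; lra.
rewrite eq; set l := ln (2500 * c).
have el : exp l = 2500 * c by rewrite exp_ln; lra.
have [hl|hl] := Rle_lt_dec l (L / 2).
  have : 50 * k * (L / 2) <= r * (L - l) by apply: Rmult_le_compat; lra.
  nra.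
(* The upper bound on [c] gives [2500 * c / exp L <= 2500 / 10 ^ 10], far below [/ exp 1]. *)
have l1 : l <= L - 1.
  apply: exp_le_inv; rewrite el exp_plus exp_Ropp.
  have : / 3 <= / exp 1 by apply: Rinv_le_contravar; [exact: exp_pos | exact: exp_le_3].
  nra.
have : (L / 2) * (L / 2) / 4 <= 2500 * c.
  rewrite -el; apply: Rle_trans (sqr_div4_le_exp _) _; first lra.
  by apply: exp_le_exp; lra.
move=> hc.
have : 18 * L <= c / 200 by nra.
move=> hc2.
have : 18 * L * k <= r by nra.
nra.
Qed.

Lemma bool_ofP (P : Prop) : reflect P (bool_of P).
Proof. by rewrite /bool_of; case: excluded_middle_informative => h; constructor. Qed.

Lemma INR_bin2 (a : nat) : INR 'C(a, 2) = INR a * (INR a - 1) / 2.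
Proof.
elim: a => [|a IH]; first by rewrite bin0n /=; field.
by rewrite binS bin1 plus_INR IH S_INR; field.
Qed.

Lemma ffact_le_expn a k : (a ^_ k <= a ^ k)%N.
Proof. by elim: k => // k IH; rewrite ffactnSr expnSr leq_mul // leq_subr. Qed.

Lemma subset_of_card (T : finType) (A : {set T}) k : (k <= #|A|)%N ->
  exists2 B : {set T}, B \subset A & #|B| = k.
Proof.
rewrite -bin_gt0 -cards_draws => /card_gt0P[B]; rewrite inE => /andP[sBA /eqP cB].
by exists B.
Qed.

(** * Bad graphs: counting them and covering all failures *)

Section RandomGraph.
Variables n m : nat.
Let nR := INR n.
Let L := ln nR.
Let c := INR m / nR.
Let M := 'C(n, 2).
Hypothesis n0 : (0 < n)%N.
Hypothesis L0 : 10 ^ 9 <= L.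
Hypothesis c0 : 10 ^ 4 <= c <= nR / 10 ^ 10.

Let nR0 : 0 < nR. Proof. by apply: lt_0_INR; apply/ltP. Qed.

Let expL : exp L = nR. Proof. exact: exp_ln. Qed.

Let nL : 10 ^ 9 <= nR.
Proof.
by have := exp_ineq1_le L; rewrite expL; lra.
Qed.

Let mE : INR m = c * nR.
Proof. by rewrite /c; field; lra. Qed.

Let ME : INR M = nR * (nR - 1) / 2.
Proof. exact: INR_bin2. Qed.

Let M0R : 0 < INR M.
Proof. by rewrite ME; nra. Qed.

Let M0 : (0 < #|pairs n|)%N.
Proof. by rewrite card_pairs; apply/ltP/INR_lt. Qed.

Let edge_density : INR m / INR M = 2 * c / (nR - 1).
Proof. by rewrite ME mE; field; lra. Qed.

Let density_le : INR m / INR M <= / 100.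
Proof.
rewrite edge_density; apply: (Rmult_le_reg_r (nR - 1)); first lra.
by rewrite /Rdiv Rmult_assoc Rinv_l; lra.
Qed.

Let mM : (m <= #|pairs n|)%N.
Proof.
rewrite card_pairs; apply/leP/INR_le; rewrite -/M.
have := density_le => /(Rmult_le_compat_r (INR M) _ _ (Rlt_le _ _ M0R)).
by rewrite /Rdiv Rmult_assoc Rinv_l; lra.
Qed.

Definition few_touching (S : {set 'I_n}) (t : nat) : {set {set {set 'I_n}}} :=
  [set E : {set {set 'I_n}} |
    [&& E \subset pairs n, #|E| == m & (#|E :&: touching S| <= t)%N]].

Lemma card_few_touching_le (S : {set 'I_n}) (t : nat) :
  INR t <= c * INR #|S| / 50 ->
  INR #|few_touching S t| <=
    (INR t + 1) *
    exp (- (99 / 100) * (c * INR #|S| * ((2 * nR - INR #|S| - 1) / (nR - 1)))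
         + 6.01 * INR t) * INR 'C(M, m).
Proof.
move=> ht.
have Sn : (#|S| <= n)%N by rewrite -[leqRHS](card_ord n) max_card.
have SnR := INR_leq Sn; rewrite -/nR in SnR.
have S0 := pos_INR #|S|.
have tm : (t <= m)%N by apply/leP/INR_le; rewrite mE; nra.
have muE : INR #|touching S| * INR m / INR M =
    c * INR #|S| * ((2 * nR - INR #|S| - 1) / (nR - 1)).
  have h := f_equal INR (card_touching S).
  rewrite plus_INR !INR_bin2 minus_INR in h; last by apply/leP.
  rewrite -/nR in h.
  have -> : INR #|touching S| = INR #|S| * (2 * nR - INR #|S| - 1) / 2 by nra.
  by rewrite ME mE; field; lra.
have := @card_draws_lower_tail _ (pairs n) m M0 mM _ t (touching_sub S).
by rewrite card_pairs -/M muE => /(_ density_le tm).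
Qed.

(** The event is split over its witnesses [Y]; disjointness gives [Y :|: perm_edge pi @: Y] exactly
    [2 * r] elements, whence the exponent [2 * r] of the density. *)
Definition stable_graphs (pi : {perm 'I_n}) (r : nat) : {set {set {set 'I_n}}} :=
  \bigcup_(Y : {set {set 'I_n}} | (Y \subset touching (moved pi)) && (#|Y| == r) &&
                [disjoint Y & perm_edge pi @: Y])
    [set E : {set {set 'I_n}} |
      [&& E \subset pairs n, #|E| == m & Y :|: perm_edge pi @: Y \subset E]].

Lemma card_stable_graphs_le (pi : {perm 'I_n}) (r : nat) :
  c * INR #|moved pi| / 200 <= INR r ->
  INR #|stable_graphs pi r| <= exp (INR r * ln (2500 * c / nR)) * INR 'C(M, m).
Proof.
move=> hr; set S := moved pi in hr *.
set p := INR m / INR M.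
have f_inj : injective (perm_edge pi) by apply: imset_inj; exact: perm_inj.
apply: (Rle_trans _ (INR 'C(#|touching S|, r) * (p ^ (2 * r)%N * INR 'C(M, m)))).
  rewrite -cards_draws /stable_graphs.
  apply: (Rle_trans _ (INR #|[pred Y : {set {set 'I_n}} | (Y \subset touching S) && (#|Y| == r) &&
                [disjoint Y & perm_edge pi @: Y]]| * (p ^ (2 * r)%N * INR 'C(M, m)))); last first.
    apply: Rmult_le_compat_r.
      apply: Rmult_le_pos (pos_INR _); apply: pow_le.
      by apply: Rmult_le_pos (pos_INR _) _; left; apply: Rinv_0_lt_compat.
    apply: INR_leq; apply: subset_leq_card; apply/subsetP=> Y; rewrite !inE.
    by case/andP.
  apply: card_bigcup_le => Y /andP[/andP[sY /eqP cY] dY].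
  have sYp := subset_trans sY (touching_sub S).
  have sU : Y :|: perm_edge pi @: Y \subset pairs n.
    rewrite subUset sYp; apply/subsetP=> _ /imsetP[e /(subsetP sYp) + ->].
    by rewrite !inE card_imset //; apply: perm_inj.
  have := card_supersets_le M0 mM sU.
  by rewrite cardsU disjoint_setI0 // cards0 subn0 card_imset // cY addnn -mul2n card_pairs.
rewrite -Rmult_assoc; apply: Rmult_le_compat_r; first exact: pos_INR.
have k0 := pos_INR #|S|.
(* The weight is chosen so that [#|touching S| * y <= c * #|S| / 200 <= r], whence
   ['C(#|touching S|, r) * y ^ r <= exp r]. With [exp 1 <= 3] the base becomes [3 * p ^ 2 / y],
   whose constant is [3 * 4 * 200 = 2400]; [2500] absorbs [nR ^ 2 / (nR - 1) ^ 2]. *)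
set y := c / (200 * nR).
have y0 : 0 < y by apply: Rdiv_lt_0_compat; lra.
have cardD : INR #|touching S| <= nR * INR #|S|.
  have Sn : (#|S| <= n)%N by rewrite -[leqRHS](card_ord n) max_card.
  have SnR := INR_leq Sn; rewrite -/nR in SnR.
  have h := f_equal INR (card_touching S).
  rewrite plus_INR !INR_bin2 minus_INR in h; last by apply/leP.
  rewrite -/nR in h; nra.
have q0 : 0 < 2500 * c / nR by apply: Rdiv_lt_0_compat; lra.
rewrite -(pow_exp (ln _)) exp_ln // pow_mult.
have -> : (p ^ 2) ^ r = y ^ r * (p ^ 2 / y) ^ r.
  by rewrite -Rpow_mult_distr; f_equal; field; lra.
rewrite -Rmult_assoc.
have p2 : 0 <= p ^ 2 / y by apply: Rmult_le_pos; [nra | left; apply: Rinv_0_lt_compat].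
apply: (Rle_trans _ (exp 1 ^ r * (p ^ 2 / y) ^ r)).
  apply: Rmult_le_compat_r; first exact: pow_le.
  apply: Rle_trans (@INR_bin_le_exp _ _ y _) _; first lra.
  rewrite pow_exp; apply: exp_le_exp.
  have : INR #|touching S| * y <= nR * INR #|S| * y by apply: Rmult_le_compat_r; lra.
  have -> : nR * INR #|S| * y = c * INR #|S| / 200 by rewrite /y; field; lra.
  lra.
rewrite -Rpow_mult_distr; apply: pow_incr; split.
  by apply: Rmult_le_pos => //; left; apply: exp_pos.
apply: (Rle_trans _ (3 * (p ^ 2 / y))).
  by apply: Rmult_le_compat_r => //; exact: exp_le_3.
rewrite /p edge_density.
have -> : 3 * ((2 * c / (nR - 1)) ^ 2 / y) = (2400 * nR ^ 2 / (nR - 1) ^ 2) * (c / nR).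
  by rewrite /y; field; lra.
rewrite /Rdiv (Rmult_assoc 2500); apply: Rmult_le_compat_r.
  by apply: Rmult_le_pos; [lra | left; apply: Rinv_0_lt_compat].
have d0 : 0 < (nR - 1) ^ 2 by nra.
apply: (Rmult_le_reg_r ((nR - 1) ^ 2)) => //.
by rewrite Rmult_assoc Rinv_l; nra.
Qed.

(** The tail bound needs [t_ k] at most [c * k / 50], hence the floor; the pair estimate needs
    [r_ k] at least [c * k / 200], hence the successor. *)
Let t_ k := nat_floor (c * INR k / 50).
Let r_ k := (nat_floor (c * INR k / 200)).+1.

(** Grouping by [S] charges the first event once per set rather than once per permutation. *)
Definition bad_graphs (S : {set 'I_n}) : {set {set {set 'I_n}}} :=
  few_touching S (t_ #|S|)
  :|: \bigcup_(pi : {perm 'I_n} | moved pi == S) stable_graphs pi (r_ #|S|).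

(** The possible numbers of moved points once [beta >= beta_star]: the term [/ nR] gives [k >= 1],
    and no permutation moves exactly one point. *)
Let admissible k := (1 < k)%N && bool_of (nR * exp (- c / 6) <= INR k).

Lemma card_bad_graphs_of_size_le k : (k <= n)%N -> admissible k ->
  INR #|\bigcup_(S : {set 'I_n} | #|S| == k) bad_graphs S|
    <= 2 * exp (- 17 * L) * INR 'C(M, m).
Proof.
move=> kn /andP[k2 /bool_ofP hk].
have k2R : 2 <= INR k by have := INR_leq k2; rewrite /=; lra.
have knR : INR k <= nR := INR_leq kn.
have ck0 : 0 <= c * INR k by apply: Rmult_le_pos; lra.
have B0 := pos_INR 'C(M, m).
have [tk _] := @nat_floorP (c * INR k / 50) ltac:(lra).
have [_ rk] := @nat_floorP (c * INR k / 200) ltac:(lra).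
rewrite -/(t_ k) in tk; rewrite -S_INR -/(r_ k) in rk.
set x1 := (INR (t_ k) + 1) *
    exp (- (99 / 100) * (c * INR k * ((2 * nR - INR k - 1) / (nR - 1)))
         + 6.01 * INR (t_ k)).
set x2 := exp (INR (r_ k) * ln (2500 * c / nR)).
apply: (Rle_trans _ (INR #|[pred S : {set 'I_n} | #|S| == k]| *
   ((x1 + INR k`! * x2) * INR 'C(M, m)))).
  apply: card_bigcup_le => S /eqP cS.
  apply: (Rle_trans _ (INR (#|few_touching S (t_ k)| +
     #|\bigcup_(pi : {perm 'I_n} | moved pi == S) stable_graphs pi (r_ k)|)%N)).
    by apply: INR_leq; rewrite /bad_graphs cS; exact: leq_card_setU.
  rewrite plus_INR Rmult_plus_distr_r; apply: Rplus_le_compat.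
    by rewrite /x1 -cS; apply: card_few_touching_le; rewrite cS.
  apply: (Rle_trans _ (INR #|[pred pi : {perm 'I_n} | moved pi == S]| * (x2 * INR 'C(M, m)))).
    apply: card_bigcup_le => pi /eqP mpi; apply: card_stable_graphs_le.
    by rewrite mpi cS; lra.
  rewrite Rmult_assoc; apply: Rmult_le_compat_r.
    by apply: Rmult_le_pos => //; left; exact: exp_pos.
  apply: INR_leq; rewrite -cS; have := card_perms_moved S.
  by rewrite cardsE.
rewrite -[#|[pred S | _]|]cardsE card_draws card_ord -Rmult_assoc.
apply: Rmult_le_compat_r => //.
rewrite Rmult_plus_distr_l.
suff [h1 h2] : INR 'C(n, k) * x1 <= exp (- 17 * L) /\
    INR 'C(n, k) * (INR k`! * x2) <= exp (- 17 * L) by lra.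
split.
  apply: (Rle_trans _ (exp (c * INR k / 6 + INR k) * x1)).
    apply: Rmult_le_compat_r.
      by apply: Rmult_le_pos; [have := pos_INR (t_ k); lra | left; exact: exp_pos].
    (* With weight [exp (- c / 6)] the exponent is [nR * exp (- c / 6)], which admissibility bounds
       by [k]. *)
    have := @INR_bin_le_exp n k (exp (- c / 6)) (Rlt_le _ _ (exp_pos _)).
    rewrite pow_exp -/nR => h.
    have h' : INR 'C(n, k) * exp (INR k * (- c / 6)) <= exp (INR k).
      by apply: Rle_trans h _; apply: exp_le_exp.
    apply: (Rmult_le_reg_r (exp (INR k * (- c / 6)))); first exact: exp_pos.
    apply: Rle_trans h' _; right; rewrite -exp_plus; f_equal; field.
  rewrite /x1 -expL; apply: few_touching_estimate => //; rewrite ?expL //; try lra.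
  by split=> //; exact: pos_INR.
(* Sets times permutations of each: ['C(n, k) * k!] is the falling factorial, at most
   [n ^ k = exp (k * L)]. *)
rewrite -Rmult_assoc -mult_INR multE bin_ffact.
apply: (Rle_trans _ (exp (INR k * L) * x2)).
  apply: Rmult_le_compat_r; first by left; exact: exp_pos.
  rewrite -pow_exp expL -INR_expn; apply: INR_leq.
  by apply: ffact_le_expn.
rewrite /x2 -exp_plus; apply: exp_le_exp; rewrite -expL.
by apply: stable_pairs_estimate => //; rewrite ?expL //; lra.
Qed.

(** At most [n + 1] sizes contribute [2 / nR ^ 17] each, and [2 * (nR + 1) <= nR ^ 2]. *)
Lemma card_bad_graphs_le :
  INR #|\bigcup_(k : 'I_n.+1 | admissible k)
          \bigcup_(S : {set 'I_n} | #|S| == k) bad_graphs S|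
    <= / nR ^ 15 * INR 'C(M, m).
Proof.
apply: (Rle_trans _ (INR #|[pred k : 'I_n.+1 | admissible k]| *
   (2 * exp (- 17 * L) * INR 'C(M, m)))).
  apply: card_bigcup_le => k ak; apply: card_bad_graphs_of_size_le => //.
  by rewrite -ltnS.
have e17 : exp (- 17 * L) = / nR ^ 17.
  rewrite Ropp_mult_distr_l_reverse exp_Ropp -expL pow_exp; do 2!f_equal.
  by rewrite INR_IZR_INZ.
have p0 : 0 < / nR ^ 17 by apply: Rinv_0_lt_compat; apply: pow_lt.
rewrite -Rmult_assoc; apply: Rmult_le_compat_r; first exact: pos_INR.
apply: (Rle_trans _ ((nR + 1) * (2 * exp (- 17 * L)))).
  apply: Rmult_le_compat_r; first by rewrite e17; lra.
  by rewrite /nR -S_INR -[in INR n.+1](card_ord n.+1); apply: INR_leq; exact: max_card.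
rewrite e17; have -> : / nR ^ 15 = nR ^ 2 * / nR ^ 17.
  by field; lra.
rewrite -Rmult_assoc; apply: Rmult_le_compat_r; first lra.
nra.
Qed.

Lemma bad_graphs_cover (E : {set {set 'I_n}}) :
  E \in Gnm_support n m ->
  ~ (forall beta, Rmax (exp (- c / 6)) (/ nR) <= beta <= 1 -> asymmetric E beta (beta / 240)) ->
  E \in \bigcup_(k : 'I_n.+1 | admissible k)
          \bigcup_(S : {set 'I_n} | #|S| == k) bad_graphs S.
Proof.
rewrite Gnm_supportE inE => /andP[sE cE] h.
have [beta hb] := not_all_ex_not _ _ h.
have [[b0 b1] hb'] := imply_to_and _ _ hb.
have [pi hpi] := not_all_ex_not _ _ hb'.
have [fixb /Rnot_lt_le hA] := imply_to_and _ _ hpi.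
set S := moved pi; set k := #|S|.
have kfix : INR k + INR (nfix pi) = nR by rewrite -plus_INR plusE card_moved.
rewrite -/nR in fixb.
have bk : beta * nR <= INR k by lra.
have be := Rle_trans _ _ _ (Rmax_l _ _) b0.
have bn := Rle_trans _ _ _ (Rmax_r _ _) b0.
have k1R : 1 <= INR k.
  apply: Rle_trans bk; have := Rmult_le_compat_r nR _ _ (Rlt_le _ _ nR0) bn.
  by rewrite Rinv_l; lra.
have k2 : (1 < k)%N.
  rewrite ltn_neqAle eq_sym card_moved_neq1 /=.
  by apply/leP/INR_le.
have k2R : 2 <= INR k by have := INR_leq k2; rewrite /=; lra.
have kn : (k < n.+1)%N by rewrite ltnS -[leqRHS](card_ord n) max_card.
apply/bigcupP; exists (Ordinal kn).
  rewrite /admissible /= k2; apply/bool_ofP.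
  by apply: Rle_trans bk; rewrite Rmult_comm; apply: Rmult_le_compat_r; lra.
apply/bigcupP; exists S => //; rewrite /bad_graphs -/k inE.
case: (leqP #|E :&: touching S| (t_ k)) => [few|many].
  by rewrite inE sE cE few.
apply/orP; right; apply/bigcupP; exists pi => //.
have [Y [sY sfY dY cY]] := exists_stable_edges E pi.
have ck0 : 10 ^ 4 * INR k <= c * INR k by apply: Rmult_le_compat_r; lra.
have [_ tk] := @nat_floorP (c * INR k / 50) ltac:(lra).
have [rk _] := @nat_floorP (c * INR k / 200) ltac:(lra).
(* At most [beta * m / 240] edges are lost, and [beta * m = c * (beta * nR) <= c * k]. *)
have lost : INR #|[set e in E | perm_edge pi e \notin E]| <= c * INR k / 240.
  have mR0 : 0 < INR m by rewrite mE; apply: Rmult_lt_0_compat; lra.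
  have split_E : INR #|[set e in E | perm_edge pi e \in E]|
             + INR #|[set e in E | perm_edge pi e \notin E]| = INR m.
    rewrite -plus_INR plusE -(eqP cE).
    rewrite -(cardsID [set e | perm_edge pi e \in E] E).
    by congr (INR (_ + _)); apply: eq_card => e; rewrite !inE // andbC.
  move: hA; rewrite /AUT (eqP cE) => hA.
  have hA' : (1 - beta / 240) * INR m <= INR #|[set e in E | perm_edge pi e \in E]|.
    have := Rmult_le_compat_r _ _ _ (Rlt_le _ _ mR0) hA.
    by rewrite /Rdiv (Rmult_assoc (INR _)) Rinv_l; lra.
  have : beta * INR m <= c * INR k by rewrite mE; nra.
  lra.
(* [1 / 50 - 1 / 240 - 1 / 10 ^ 4] exceeds [3 / 200], and since [c * k >= 2 * 10 ^ 4] the surplus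
   pays for the successor in [r_ k]. *)
have rY : (r_ k <= #|Y|)%N.
  apply/leP/INR_le; rewrite /r_ S_INR.
  have := INR_leq cY; rewrite 2!plus_INR mult_INR -/k.
  have := INR_leq many; rewrite S_INR /t_ -/S.
  rewrite (_ : INR 3 = 3); last by rewrite /=; ring.
  lra.
(* [stable_graphs] asks for exactly [r_ k] pairs; disjointness from the image passes to subsets. *)
have [Z sZY cZ] := subset_of_card rY.
have /subsetIP[sZE sZS] := subset_trans sZY sY.
have sfZ : perm_edge pi @: Z \subset perm_edge pi @: Y by exact: imsetS.
apply/bigcupP; exists Z; last by rewrite inE sE cE subUset sZE (subset_trans sfZ).
by rewrite sZS cZ eqxx (disjointWl sZY) // (disjointWr sfZ).
Qed.

End RandomGraph.

(** * From the count of bad graphs to the probability bound *)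

Theorem theorem1p4 :
  exists N : nat, forall n : nat, (N <= n)%N ->
  forall m : nat,
    let c := INR m / INR n in
    10 ^ 4 <= c <= INR n / 10 ^ 10 ->
    let beta_star := Rmax (exp (- c / 6)) (/ INR n) in
    @prob_Gnm n m
       (fun E => forall beta : R, beta_star <= beta <= 1 ->
                   asymmetric E beta (beta / 240))
     >= 1 - / (INR n ^ 15).
Proof.
(* This threshold ensures [ln n >= 10 ^ 9]. *)
exists (nat_floor (exp (10 ^ 9))).+1 => n hn m c c0 beta_star.
have [_ hN] := nat_floorP (Rlt_le _ _ (exp_pos (10 ^ 9))).
have hnR : exp (10 ^ 9) <= INR n.
  by have := INR_leq hn; rewrite S_INR; lra.
have n0 : (0 < n)%N by apply: leq_trans hn.
have nR0 : 0 < INR n by have := exp_pos (10 ^ 9); lra.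
have L0 : 10 ^ 9 <= ln (INR n).
  by apply: exp_le_inv; rewrite exp_ln.
have bad := card_bad_graphs_le n0 L0 c0.
have cover := @bad_graphs_cover n m n0 c0.
set P := fun E => _; set U := \bigcup_(k | _) _ in bad cover.
(* The upper bound on [c] gives [m <= 'C(n, 2)], so the support is nonempty and the quotient is a
   genuine probability. *)
have C0 : 0 < INR 'C('C(n, 2), m).
  apply: lt_0_INR; apply/ltP; rewrite bin_gt0.
  apply/leP/INR_le; rewrite INR_bin2.
  have : INR m = c * INR n by rewrite /c; field; lra.
  have := exp_ineq1_le (10 ^ 9); nra.
have : (#|Gnm_support n m| <= #|[set E in Gnm_support n m | bool_of (P E)]| + #|U|)%N.
  apply: leq_trans (leq_card_setU _ _); apply: subset_leq_card.
  apply/subsetP=> E hE; rewrite in_setU inE hE /=.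
  by case: bool_ofP => //= nP; apply: cover.
move/INR_leq; rewrite /prob_Gnm card_Gnm_support plus_INR => h.
apply: Rle_ge; apply: (Rmult_le_reg_r _ _ _ C0).
rewrite /Rdiv Rmult_assoc Rinv_l; lra.
Qed.
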